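(* The class of integral means of the second kind is minimal and complete. That is: (minimality) if $M_1,M_2$ are integral means of the second kind with $Q_{M_1}=Q_{M_2}$, then $M_1=M_2$; (completeness) for every infinitely differentiable function $u:(0,+\infty)\to\mathbb{R}$ there exists an integral mean of the second kind $M$ with $Q_M=u$.
   Context: A mean is a function $M:(0,+\infty)^2\to(0,+\infty)$ of class $C^\infty$ such that $\min(x,y)\le M(x,y)\le\max(x,y)$ and $M(x,y)=M(y,x)$ for all $x,y>0$. The characteristic function of a mean $M$ is $Q_M:(0,+\infty)\to\mathbb{R}$, $Q_M(x):=\frac{\partial^2 M}{\partial x^2}(x,x)$ (second partial derivative with respect to the first variable, evaluated at $(x,x)$). A mean $M$ is an integral mean of the second kind if there is an interval $I\subseteq\mathbb{R}$ and a strictly monotonic and infinitely differentiable function $f$ on $I$ with $f(I)=(0,+\infty)$ such that $M(f(x),f(y))=\frac{1}{y-x}\int_x^y f(t)\,dt$ for all $x,y\in I$ with $x\neq y$ (the interval $I$ and the function $f$ may depend on $M$). *)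

(* Defs.v *)
From Stdlib Require Export Reals.
From Coquelicot Require Export Coquelicot.
Open Scope R_scope.

(* Functions on (0,+oo), on (0,+oo)^2 or on an interval are represented by
   total functions on R; only their values on the domain are constrained, and
   equality of such functions means agreement on the domain. *)

(* [D] is meant to be open.  For the intervals below this is automatic: a
   continuous strictly monotonic function with image (0,+oo) can only live on
   an open interval, so no one-sided derivatives at endpoints are involved. *)
Definition smooth_on (D : R -> Prop) (f : R -> R) : Prop :=
  forall (n : nat) (x : R), D x -> ex_derive_n f n x.

(* [ex_diff_n M n x y] requires all iterated partial derivatives of [M] of
   order at most [n], mixed ones in any order, to exist and be continuous
   at (x, y). *)
Definition smooth_pos2 (M : R -> R -> R) : Prop :=
  forall (n : nat) (x y : R), 0 < x -> 0 < y -> ex_diff_n M n x y.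

Definition is_mean (M : R -> R -> R) : Prop :=
  smooth_pos2 M /\
  (forall x y : R, 0 < x -> 0 < y -> Rmin x y <= M x y <= Rmax x y) /\
  (forall x y : R, 0 < x -> 0 < y -> M x y = M y x).

Definition char_fun (M : R -> R -> R) (x : R) : R := partial_derive 2 0 M x x.

Definition strictly_monotonic_on (D : R -> Prop) (f : R -> R) : Prop :=
  (forall x y : R, D x -> D y -> x < y -> f x < f y) \/
  (forall x y : R, D x -> D y -> x < y -> f y < f x).

(* Coquelicot's [is_connected] is order-convexity, i.e. being an interval. *)
Definition integral_mean_second_kind (M : R -> R -> R) : Prop :=
  is_mean M /\
  exists (I : R -> Prop) (f : R -> R),
    is_connected I /\
    strictly_monotonic_on I f /\
    smooth_on I f /\
    (forall z : R, (exists t : R, I t /\ f t = z) <-> 0 < z) /\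
    (forall x y : R, I x -> I y -> x <> y ->
       M (f x) (f y) = 1 / (y - x) * RInt f x y).

(* Main.v *)
Require Import Defs.
From Stdlib Require Import Reals Ranalysis5 Lra ClassicalEpsilon.
From Coquelicot Require Import Coquelicot.
Open Scope R_scope.

(** An integral mean of the second kind is a barycentre with respect to
    a smooth density.  If [g] is the inverse of [f] and [h = g'], the substitution
    [t = g s] turns the defining identity into
    [M a b * int_a^b h = int_a^b s * h s ds], that is, [M a b] is the
    barycentre of the density [h] on the interval between [a] and [b]
    ([second_kind_barycentric]).  The function [g] is smooth because [f'] never
    vanishes: differentiating the defining identity in [x] at a zero of [f']
    would make [f x] the average of the strictly monotonic [f] over an interval
    starting at [x] ([second_kind_derive_neq_0]).

    Differentiating [M t x * int_x^t h = int_x^t s * h s ds] three times in [t]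
    at [t = x] gives [Q_M = h' / (6 h)] ([char_fun_barycentric]).  So [Q_M]
    determines the logarithmic derivative of [h], hence [h] up to a constant
    factor, and such a factor cancels in the barycentre: this is minimality.

    Conversely, for a given [u] the density [h = exp (6 * int_1^x u)] satisfies
    [h' / (6 h) = u], and its barycentre is a mean of the second kind, with [f]
    the inverse of a primitive of [h] ([weighted_mean_second_kind]).  The one
    delicate point is that this quotient of two integrals is smooth across the
    diagonal, where both integrals vanish.  Rescaling the interval to [[0, 1]]
    divides both by [b - a]: the mean becomes a quotient of integrals of
    [phi ((1 - t) * x + t * y)] over [t], the denominator is positive
    everywhere, and one may differentiate under the integral sign ([J_Cn2]). *)

(** * Functions of one variable with n continuous derivatives *)

Definition halfline (x : R) : Prop := 0 < x.

Definition is_open (D : R -> Prop) : Prop := forall x, D x -> locally x D.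

Lemma halfline_open : is_open halfline.
Proof. intros x Hx. exact (open_gt 0 x Hx). Qed.

Lemma is_derive_multR (f g : R -> R) (x a b : R) :
  is_derive f x a -> is_derive g x b ->
  is_derive (fun t => f t * g t) x (a * g x + f x * b).
Proof. intros Hf Hg. apply (is_derive_mult f g x a b Hf Hg). exact Rmult_comm. Qed.

Lemma is_derive_plusR (f g : R -> R) (x a b : R) :
  is_derive f x a -> is_derive g x b ->
  is_derive (fun t => f t + g t) x (a + b).
Proof. intros Hf Hg. apply (is_derive_plus f g x a b Hf Hg). Qed.

Lemma is_derive_compR (f g : R -> R) (x a b : R) :
  is_derive f (g x) a -> is_derive g x b ->
  is_derive (fun t => f (g t)) x (a * b).
Proof.
  intros Hf Hg. rewrite Rmult_comm. apply (is_derive_comp f g x a b Hf Hg).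
Qed.

Lemma is_derive_contR (f : R -> R) (x l : R) : is_derive f x l -> continuous f x.
Proof. intros H. apply (@ex_derive_continuous R_AbsRing R_NormedModule). now exists l. Qed.

Lemma derive_eq_on_open (D : R -> Prop) (f g : R -> R) (x a b : R) :
  is_open D -> D x -> (forall t, D t -> f t = g t) ->
  is_derive f x a -> is_derive g x b -> a = b.
Proof.
  intros HD Hx Heq Hf Hg.
  rewrite <- (is_derive_unique g x b Hg).
  symmetry. apply is_derive_unique.
  apply is_derive_ext_loc with (f := f); [|exact Hf].
  generalize (HD x Hx). apply filter_imp. exact Heq.
Qed.

(** The derivative is asked for as a witness instead of being [Derive f]: closure
    under products, compositions and inverses then becomes an induction on [n]
    in which each step exhibits the formula for the derivative. *)
Fixpoint Cn_on (D : R -> Prop) (n : nat) (f : R -> R) : Prop :=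
  match n with
  | O => forall x, D x -> continuous f x
  | S n => exists f', (forall x, D x -> is_derive f x (f' x)) /\ Cn_on D n f'
  end.

Definition smooth (D : R -> Prop) (f : R -> R) : Prop := forall n, Cn_on D n f.

Lemma Cn_on_pred D n : forall f, Cn_on D (S n) f -> Cn_on D n f.
Proof.
  induction n as [|n IH]; intros f (f' & Hd & Hn).
  - intros x Hx. apply (is_derive_contR _ _ _ (Hd x Hx)).
  - exists f'. split; [exact Hd | now apply IH].
Qed.

Lemma Cn_on_cont D n f : Cn_on D n f -> forall x, D x -> continuous f x.
Proof.
  induction n as [|n IH]; [easy | intros H; apply IH; now apply Cn_on_pred].
Qed.

Lemma Cn_on_ext D n f g :
  is_open D -> (forall x, D x -> f x = g x) -> Cn_on D n f -> Cn_on D n g.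
Proof.
  intros HD Heq.
  assert (Hl : forall x, D x -> locally x (fun t => f t = g t)).
  { intros x Hx. generalize (HD x Hx). apply filter_imp. exact Heq. }
  destruct n as [|n].
  - intros H x Hx. apply (continuous_ext_loc g f x).
    + generalize (HD x Hx). apply filter_imp. intros t Ht. now apply Heq.
    + now apply H.
  - intros (f' & Hd & Hn). exists f'. split; [|exact Hn].
    intros x Hx. apply is_derive_ext_loc with (f := f); auto.
Qed.

Lemma Cn_on_const D n : forall c, Cn_on D n (fun _ => c).
Proof.
  induction n as [|n IH]; intros c.
  - intros x _. apply continuous_const.
  - exists (fun _ => 0). split; [|apply IH]. intros x _. apply @is_derive_const.
Qed.

Lemma Cn_on_id D n : Cn_on D n (fun x => x).
Proof.
  destruct n as [|n].
  - intros x _. apply continuous_id.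
  - exists (fun _ => 1). split; [|apply Cn_on_const]. intros x _. apply @is_derive_id.
Qed.

Lemma Cn_on_plus D n : forall f g, Cn_on D n f -> Cn_on D n g -> Cn_on D n (fun x => f x + g x).
Proof.
  induction n as [|n IH]; intros f g.
  - intros Hf Hg x Hx. apply (continuous_plus f g x); auto.
  - intros (f' & Hf & Hf') (g' & Hg & Hg').
    exists (fun x => f' x + g' x). split; [|now apply IH].
    intros x Hx. apply is_derive_plusR; auto.
Qed.

Lemma Cn_on_mult D n : forall f g, Cn_on D n f -> Cn_on D n g -> Cn_on D n (fun x => f x * g x).
Proof.
  induction n as [|n IH]; intros f g Hf Hg.
  - intros x Hx. apply (continuous_mult f g x); auto.
  - pose proof (Cn_on_pred _ _ _ Hf) as Hf0. pose proof (Cn_on_pred _ _ _ Hg) as Hg0.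
    destruct Hf as (f' & Hf & Hf'). destruct Hg as (g' & Hg & Hg').
    exists (fun x => f' x * g x + f x * g' x). split.
    + intros x Hx. apply is_derive_multR; auto.
    + apply Cn_on_plus; now apply IH.
Qed.

Lemma Cn_on_comp D E n : forall a f,
  (forall x, D x -> E (f x)) -> Cn_on E n a -> Cn_on D n f -> Cn_on D n (fun x => a (f x)).
Proof.
  induction n as [|n IH]; intros a f HDE Ha Hf.
  - intros x Hx. apply continuous_comp; auto.
  - pose proof (Cn_on_pred _ _ _ Hf) as Hf0.
    destruct Ha as (a' & Ha & Ha'). destruct Hf as (f' & Hf & Hf').
    exists (fun x => a' (f x) * f' x). split.
    + intros x Hx. apply is_derive_compR; auto.
    + apply Cn_on_mult; [apply IH|]; auto.
Qed.

Lemma Cn_on_inv n : Cn_on (fun x => x <> 0) n Rinv.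
Proof.
  induction n as [|n IH].
  - intros x Hx. apply continuous_Rinv; exact Hx.
  - exists (fun x => (-1) * (/ x * / x)). split.
    + intros x Hx.
      replace (-1 * (/ x * / x)) with (- 1 / x ^ 2) by (field; exact Hx).
      apply (is_derive_inv (fun t => t) x 1); [apply @is_derive_id | exact Hx].
    + apply Cn_on_mult; [apply Cn_on_const | now apply Cn_on_mult].
Qed.

(** The next three lemmas relate [smooth] to [smooth_on].  In this direction the
    witnesses are the iterated derivatives themselves; in the other one, [D] has
    to be open so that a derivative taken on [D] is the one computed by [Derive]. *)
Lemma smooth_on_Cn_on D f : smooth_on D f -> forall n, Cn_on D n f.
Proof.
  intros H n.
  cut (forall k, Cn_on D n (Derive_n f k)); [intros Hk; exact (Hk O)|].
  induction n as [|n IH]; intros k.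
  - intros x Hx. apply (@ex_derive_continuous R_AbsRing R_NormedModule).
    exact (H (S k) x Hx).
  - exists (Derive_n f (S k)). split; [|apply IH].
    intros x Hx. apply Derive_correct. exact (H (S k) x Hx).
Qed.

Lemma Cn_on_Derive D n f : is_open D -> Cn_on D (S n) f -> Cn_on D n (Derive f).
Proof.
  intros HD (f' & Hd & Hn). apply Cn_on_ext with (f := f'); auto.
  intros x Hx. symmetry. apply is_derive_unique. auto.
Qed.

Lemma Cn_on_smooth_on D f : is_open D -> (forall n, Cn_on D n f) -> smooth_on D f.
Proof.
  intros HD H n x Hx. destruct n as [|n]; [exact I|].
  assert (Hk : forall k m, Cn_on D m (Derive_n f k)).
  { induction k as [|k IH]; intros m; [apply H | apply Cn_on_Derive; auto]. }
  destruct (Hk n 1%nat) as (f' & Hd & _). exists (f' x). auto.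
Qed.

(** * Inverse functions *)

(** With [dw = w - b] and [dg = g w - g b], the derivative of [f] at [g b] says
    that [dw] is close to [l * dg] relatively to [dg].  Since [l <> 0], [dg] is at
    most of the order of [dw], so the error is also small relatively to [dw]. *)
Lemma is_derive_inverse (f g : R -> R) (b l : R) :
  is_derive f (g b) l -> l <> 0 -> continuous g b ->
  locally b (fun w => f (g w) = w) -> is_derive g b (/ l).
Proof.
  intros [_ Hf] Hl Hg Hfg. split; [apply is_linear_scal_l|].
  intros y Hy.
  assert (E : b = y).
  { apply (@is_filter_lim_locally_unique R_AbsRing R_NormedModule b y). exact Hy. }
  subst y.
  intros eps.
  assert (Hal : 0 < Rabs l) by now apply Rabs_pos_lt.
  (* The first bound on [e] gives [|dg| <= 2 |dw| / |l|]; the second turns the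
     remaining error [e |dg| / |l|] into at most [eps |dw|]. *)
  set (e := Rmin (Rabs l / 2) (eps * (Rabs l * Rabs l) / 2)).
  assert (He1 : e <= Rabs l / 2) by apply Rmin_l.
  assert (He2 : e <= eps * (Rabs l * Rabs l) / 2) by apply Rmin_r.
  assert (He : 0 < e).
  { apply Rmin_pos; [lra|]. pose proof (cond_pos eps).
    apply Rdiv_lt_0_compat; [|lra]. repeat apply Rmult_lt_0_compat; lra. }
  specialize (Hf (g b) (fun P HP => HP) (mkposreal e He)).
  apply Hg in Hf. unfold filtermap in Hf.
  generalize (filter_and _ _ Hf Hfg). apply filter_imp.
  intros w [Hw Hw']. pose proof (locally_singleton _ _ Hfg) as Hb.
  cbv beta in Hb.
  rewrite Hw', Hb in Hw. revert Hw.
  unfold norm, minus, plus, opp, scal, mult; simpl.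
  unfold abs, mult; simpl. intros Hw.
  set (dg := g w + - g b) in *. set (dw := w + - b) in *.
  assert (H1 : Rabs dg * Rabs l <= 2 * Rabs dw).
  { assert (Rabs (dg * l) <= Rabs dw + e * Rabs dg).
    { replace (dg * l) with (dw - (dw + - (dg * l))) by ring.
      eapply Rle_trans; [apply Rabs_triang|]. rewrite Rabs_Ropp. lra. }
    rewrite Rabs_mult in H.
    assert (e * Rabs dg <= Rabs l / 2 * Rabs dg).
    { apply Rmult_le_compat_r; [apply Rabs_pos | exact He1]. }
    nra. }
  replace (dg + - (dw * / l)) with (- (dw + - (dg * l)) * / l) by (field; exact Hl).
  rewrite Rabs_mult, Rabs_Ropp, Rabs_inv.
  apply Rmult_le_reg_r with (Rabs l); [exact Hal|].
  rewrite Rmult_assoc, Rinv_l, Rmult_1_r by lra.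
  eapply Rle_trans; [exact Hw|].
  apply Rle_trans with (eps * (Rabs l * Rabs l) / 2 * Rabs dg).
  { apply Rmult_le_compat_r; [apply Rabs_pos | exact He2]. }
  pose proof (cond_pos eps).
  assert (0 <= eps * Rabs l) by (apply Rmult_le_pos; lra).
  nra.
Qed.

(** The equation [g' = 1 / (f' o g)] gives [g] one more derivative than it is
    already known to have, starting from continuity. *)
Lemma smooth_inverse (A B : R -> Prop) (f g : R -> R) :
  is_open A -> is_open B -> smooth A f -> (forall a, A a -> Derive f a <> 0) ->
  (forall b, B b -> A (g b) /\ f (g b) = b) ->
  (forall b, B b -> continuous g b) ->
  (forall b, B b -> is_derive g b (/ Derive f (g b))) /\ smooth B g.
Proof.
  intros HA HB Hf Hn0 Hg Hc.
  assert (Hd : forall b, B b -> is_derive g b (/ Derive f (g b))).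
  { intros b Hb. destruct (Hg b Hb) as [Ha _].
    apply is_derive_inverse with f; auto.
    - destruct (Hf 1%nat) as (f' & Hf' & _). apply Derive_correct.
      exists (f' (g b)). auto.
    - generalize (HB b Hb). apply filter_imp. intros w Hw. now apply Hg. }
  split; [exact Hd|]. intros n. induction n as [|n IH]; [exact Hc|].
  exists (fun b => / Derive f (g b)). split; [exact Hd|].
  apply Cn_on_comp with (E := A) (a := fun a => / Derive f a); auto.
  - intros b Hb. now apply Hg.
  - apply Cn_on_comp with (E := fun x => x <> 0); auto.
    + apply Cn_on_inv.
    + apply Cn_on_Derive; auto.
Qed.

(** A monotonic function is continuous as soon as its image is open: near [g b]
    there are values of [g] on either side, and the points where they are taken
    enclose a neighbourhood of [b]. *)
Lemma monotone_continuous (A B : R -> Prop) (g : R -> R) :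
  is_open A -> is_open B -> strictly_monotonic_on B g ->
  (forall b, B b -> A (g b)) -> (forall a, A a -> exists b, B b /\ g b = a) ->
  forall b, B b -> continuous g b.
Proof.
  intros HA HB Hm HBA Hs b Hb.
  apply filterlim_locally. intros eps.
  destruct (HA (g b) (HBA b Hb)) as [d Hd].
  set (e := Rmin (d / 2) (eps / 2)).
  pose proof (cond_pos eps). pose proof (cond_pos d).
  assert (He1 : e <= d / 2) by apply Rmin_l.
  assert (He2 : e <= eps / 2) by apply Rmin_r.
  assert (He : 0 < e) by (apply Rmin_pos; lra).
  destruct (Hs (g b - e)) as (p & Hp & Hgp).
  { apply Hd. apply Rabs_lt_between'. lra. }
  destruct (Hs (g b + e)) as (q & Hq & Hgq).
  { apply Hd. apply Rabs_lt_between'. lra. }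
  assert (Hbe : forall x y, B x -> B y -> g x < g y ->
     (forall x y, B x -> B y -> x < y -> g x < g y) -> x < y).
  { intros x y Hx Hy Hxy Hi. destruct (Rlt_or_le x y) as [h|[h|h]]; auto.
    - specialize (Hi y x Hy Hx h). lra.
    - subst; lra. }
  assert (Hbd : forall x y, B x -> B y -> g x < g y ->
     (forall x y, B x -> B y -> x < y -> g y < g x) -> y < x).
  { intros x y Hx Hy Hxy Hi. destruct (Rlt_or_le y x) as [h|[h|h]]; auto.
    - specialize (Hi x y Hx Hy h). lra.
    - subst; lra. }
  destruct Hm as [Hm|Hm].
  - assert (p < b) by (apply Hbe; auto; lra). assert (b < q) by (apply Hbe; auto; lra).
    generalize (filter_and _ _ (HB b Hb)
      (filter_and _ _ (open_gt p b H1) (open_lt q b H2))).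
    apply filter_imp. intros w (Hw & Hpw & Hwq).
    pose proof (Hm _ _ Hp Hw Hpw). pose proof (Hm _ _ Hw Hq Hwq).
    apply Rabs_lt_between'. lra.
  - assert (b < p) by (apply Hbd; auto; lra). assert (q < b) by (apply Hbd; auto; lra).
    generalize (filter_and _ _ (HB b Hb)
      (filter_and _ _ (open_gt q b H2) (open_lt p b H1))).
    apply filter_imp. intros w (Hw & Hqw & Hwp).
    pose proof (Hm _ _ Hw Hp Hwp). pose proof (Hm _ _ Hq Hw Hqw).
    apply Rabs_lt_between'. lra.
Qed.

Lemma interval_open (I : R -> Prop) :
  is_connected I -> (forall t, I t -> exists a b, I a /\ I b /\ a < t < b) -> is_open I.
Proof.
  intros Hc H t Ht. destruct (H t Ht) as (a & b & Ha & Hb & Hat & Htb).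
  generalize (filter_and _ _ (open_gt a t Hat) (open_lt b t Htb)).
  apply filter_imp. intros w [H1 H2]. apply (Hc a b w Ha Hb). split; now apply Rlt_le.
Qed.

Lemma choose_inverse (A B : R -> Prop) (f : R -> R) :
  (forall b, B b -> exists a, A a /\ f a = b) ->
  exists g, forall b, B b -> A (g b) /\ f (g b) = b.
Proof.
  intros H.
  exists (fun b => epsilon (inhabits 0) (fun a => A a /\ f a = b)).
  intros b Hb. apply epsilon_spec. auto.
Qed.

Lemma inverse_monotone (A B : R -> Prop) (f g : R -> R) :
  strictly_monotonic_on A f -> (forall b, B b -> A (g b) /\ f (g b) = b) ->
  strictly_monotonic_on B g.
Proof.
  intros Hm Hg.
  assert (forall x y, B x -> B y -> x < y -> g x <> g y).
  { intros x y Hx Hy Hxy E. destruct (Hg x Hx), (Hg y Hy).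
    rewrite E in H0. lra. }
  destruct Hm as [Hm|Hm]; [left|right]; intros x y Hx Hy Hxy;
  specialize (H x y Hx Hy Hxy);
  destruct (Hg x Hx) as [Ax Ex], (Hg y Hy) as [Ay Ey];
  apply Rnot_le_lt; intros [L|L]; try (specialize (Hm _ _ Ay Ax L)); 
   try (specialize (Hm _ _ Ax Ay L)); try lra; auto.
Qed.

(** * Functions of two variables on the open quadrant *)

(** As for one variable, the partial derivatives are witnesses.  Continuity is
    asked for at every order because existence of partial derivatives does not
    imply it. *)
Fixpoint Cn2 (n : nat) (F : R -> R -> R) : Prop :=
  (forall x y, 0 < x -> 0 < y -> continuity_2d_pt F x y) /\
  match n with
  | O => True
  | S n => exists Fx Fy,
      (forall x y, 0 < x -> 0 < y -> is_derive (fun z => F z y) x (Fx x y)) /\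
      (forall x y, 0 < x -> 0 < y -> is_derive (fun z => F x z) y (Fy x y)) /\
      Cn2 n Fx /\ Cn2 n Fy
  end.

Lemma Cn2_cont n F : Cn2 n F -> forall x y, 0 < x -> 0 < y -> continuity_2d_pt F x y.
Proof. destruct n; intros [H _]; exact H. Qed.

Lemma Cn2_pred n : forall F, Cn2 (S n) F -> Cn2 n F.
Proof.
  induction n as [|n IH]; intros F (H & Fx & Fy & Hx & Hy & Cx & Cy).
  - now split.
  - split; [exact H|]. exists Fx, Fy. auto.
Qed.

Lemma quadrant_open x y (P : R -> R -> Prop) :
  0 < x -> 0 < y -> (forall u v, 0 < u -> 0 < v -> P u v) -> locally_2d P x y.
Proof.
  intros Hx Hy H. exists (mkposreal _ (Rmin_pos x y Hx Hy)). simpl.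
  intros u v Hu Hv. pose proof (Rmin_l x y). pose proof (Rmin_r x y).
  apply Rabs_def2 in Hu. apply Rabs_def2 in Hv. apply H; lra.
Qed.

Lemma Cn2_ex_diff_n n : forall F, Cn2 n F ->
  forall x y, 0 < x -> 0 < y -> ex_diff_n F n x y.
Proof.
  induction n as [|n IH]; intros F HF x y Px Py.
  - split; [now apply HF | exact I].
  - destruct HF as (H & Fx & Fy & Hx & Hy & Cx & Cy).
    split; [auto|]. split; [exists (Fx x y); auto|]. split; [exists (Fy x y); auto|].
    split.
    + apply ex_diff_n_ext_loc with Fx; [|auto].
      apply quadrant_open; auto. intros u v Hu Hv. symmetry.
      apply is_derive_unique. auto.
    + apply ex_diff_n_ext_loc with Fy; [|auto].
      apply quadrant_open; auto. intros u v Hu Hv. symmetry.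
      apply is_derive_unique. auto.
Qed.

Lemma Cn2_const n : forall c, Cn2 n (fun _ _ => c).
Proof.
  induction n as [|n IH]; intros c.
  - split; [intros; apply continuity_2d_pt_const | exact I].
  - split; [intros; apply continuity_2d_pt_const|].
    exists (fun _ _ => 0), (fun _ _ => 0).
    split; [|split; [|split; apply IH]]; intros; apply @is_derive_const.
Qed.

Lemma Cn2_plus n : forall F G, Cn2 n F -> Cn2 n G -> Cn2 n (fun x y => F x y + G x y).
Proof.
  induction n as [|n IH]; intros F G HF HG; split;
    try (intros; apply continuity_2d_pt_plus; [eapply Cn2_cont | eapply Cn2_cont]; eauto);
    try exact I.
  destruct HF as (_ & Fx & Fy & Fdx & Fdy & CFx & CFy).
  destruct HG as (_ & Gx & Gy & Gdx & Gdy & CGx & CGy).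
  exists (fun x y => Fx x y + Gx x y), (fun x y => Fy x y + Gy x y).
  split; [|split; [|split; now apply IH]]; intros x y Hx Hy.
  - apply (is_derive_plusR (fun z => F z y) (fun z => G z y)); auto.
  - apply (is_derive_plusR (fun z => F x z) (fun z => G x z)); auto.
Qed.

Lemma Cn2_mult n : forall F G, Cn2 n F -> Cn2 n G -> Cn2 n (fun x y => F x y * G x y).
Proof.
  induction n as [|n IH]; intros F G HF HG; split;
    try (intros; apply continuity_2d_pt_mult; [eapply Cn2_cont | eapply Cn2_cont]; eauto);
    try exact I.
  pose proof (Cn2_pred _ _ HF) as F0. pose proof (Cn2_pred _ _ HG) as G0.
  destruct HF as (_ & Fx & Fy & Fdx & Fdy & CFx & CFy).
  destruct HG as (_ & Gx & Gy & Gdx & Gdy & CGx & CGy).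
  exists (fun x y => Fx x y * G x y + F x y * Gx x y),
         (fun x y => Fy x y * G x y + F x y * Gy x y).
  split; [|split; [|split]].
  - intros x y Hx Hy. apply (is_derive_multR (fun z => F z y) (fun z => G z y)); auto.
  - intros x y Hx Hy. apply (is_derive_multR (fun z => F x z) (fun z => G x z)); auto.
  - apply Cn2_plus; now apply IH.
  - apply Cn2_plus; now apply IH.
Qed.

Lemma Cn2_inv n : forall F, (forall x y, 0 < x -> 0 < y -> F x y <> 0) ->
  Cn2 n F -> Cn2 n (fun x y => / F x y).
Proof.
  induction n as [|n IH]; intros F Hn0 HF; split;
    try (intros; apply continuity_2d_pt_inv; [eapply Cn2_cont; eauto | auto]);
    try exact I.
  pose proof (Cn2_pred _ _ HF) as F0.
  destruct HF as (_ & Fx & Fy & Fdx & Fdy & CFx & CFy).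
  exists (fun x y => (-1) * Fx x y * (/ F x y * / F x y)),
         (fun x y => (-1) * Fy x y * (/ F x y * / F x y)).
  split; [|split; [|split]].
  - intros x y Hx Hy.
    replace (-1 * Fx x y * (/ F x y * / F x y)) with (- Fx x y / F x y ^ 2)
      by (field; auto).
    apply (is_derive_inv (fun z => F z y)); auto.
  - intros x y Hx Hy.
    replace (-1 * Fy x y * (/ F x y * / F x y)) with (- Fy x y / F x y ^ 2)
      by (field; auto).
    apply (is_derive_inv (fun z => F x z)); auto.
  - apply Cn2_mult; apply Cn2_mult; auto using Cn2_const.
  - apply Cn2_mult; apply Cn2_mult; auto using Cn2_const.
Qed.

(** * Averages along a segment *)

(** [J 0 0 phi x y] is the average of [phi] between [x] and [y], written so that
    [x = y] is not exceptional.  The weights [t ^ i * (1 - t) ^ j] make the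
    family stable under partial derivatives: each one in [x] brings out a factor
    [1 - t], each one in [y] a factor [t]. *)
Definition J (i j : nat) (phi : R -> R) (x y : R) : R :=
  RInt (fun t => t ^ i * (1 - t) ^ j * phi ((1 - t) * x + t * y)) 0 1.

Lemma segment_pos x y t : 0 < x -> 0 < y -> 0 <= t <= 1 -> 0 < (1 - t) * x + t * y.
Proof.
  intros Hx Hy Ht. destruct (Rle_lt_dec t (1/2)).
  - assert (0 <= t * y) by nra. nra.
  - assert (0 <= (1 - t) * x) by nra. nra.
Qed.

Lemma segment_between x y t :
  0 <= t <= 1 -> Rmin x y <= (1 - t) * x + t * y <= Rmax x y.
Proof.
  intros Ht.
  pose proof (Rmin_l x y). pose proof (Rmin_r x y).
  pose proof (Rmax_l x y). pose proof (Rmax_r x y).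
  assert (P : forall a b, 0 <= a -> 0 <= b -> 0 <= a * b) by (intros; now apply Rmult_le_pos).
  pose proof (P (1 - t) (x - Rmin x y) ltac:(lra) ltac:(lra)).
  pose proof (P t (y - Rmin x y) ltac:(lra) ltac:(lra)).
  pose proof (P (1 - t) (Rmax x y - x) ltac:(lra) ltac:(lra)).
  pose proof (P t (Rmax x y - y) ltac:(lra) ltac:(lra)).
  lra.
Qed.

Lemma weight_continuous (i j : nat) t : continuous (fun t : R => t ^ i * (1 - t) ^ j) t.
Proof.
  apply (@ex_derive_continuous R_AbsRing R_NormedModule). auto_derive. exact I.
Qed.

Lemma J_integrand_continuous i j phi x y :
  (forall s, halfline s -> continuous phi s) -> 0 < x -> 0 < y ->
  forall t, 0 <= t <= 1 ->
  continuous (fun t => t ^ i * (1 - t) ^ j * phi ((1 - t) * x + t * y)) t.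
Proof.
  intros Hphi Hx Hy t Ht.
  apply (continuous_mult (fun t : R => t ^ i * (1 - t) ^ j)
          (fun t => phi ((1 - t) * x + t * y)) t).
  - apply weight_continuous.
  - apply (continuous_comp (fun t => (1 - t) * x + t * y) phi).
    + apply (@ex_derive_continuous R_AbsRing R_NormedModule). auto_derive. exact I.
    + apply Hphi. now apply segment_pos.
Qed.

Lemma J_integrable i j phi x y :
  (forall s, halfline s -> continuous phi s) -> 0 < x -> 0 < y ->
  ex_RInt (fun t => t ^ i * (1 - t) ^ j * phi ((1 - t) * x + t * y)) 0 1.
Proof.
  intros Hphi Hx Hy. apply (@ex_RInt_continuous R_CompleteNormedModule).
  rewrite Rmin_left, Rmax_right by lra.
  apply J_integrand_continuous; auto.
Qed.

(** The substitution [t := 1 - t].  It gives the symmetry of the mean, and it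
    reduces derivatives in [y] to derivatives in [x]. *)
Lemma J_sym i j phi x y :
  (forall s, halfline s -> continuous phi s) -> 0 < x -> 0 < y ->
  J i j phi x y = J j i phi y x.
Proof.
  intros Hphi Hx Hy. unfold J.
  set (k := fun t => t ^ i * (1 - t) ^ j * phi ((1 - t) * x + t * y)).
  pose proof (J_integrable i j phi x y Hphi Hx Hy) as Hex. fold k in Hex.
  assert (E := RInt_comp_lin k (-1) 1 0 1).
  replace (-1 * 0 + 1) with 1 in E by ring. replace (-1 * 1 + 1) with 0 in E by ring.
  specialize (E (ex_RInt_swap _ _ _ Hex)).
  rewrite <- (opp_RInt_swap k 1 0) by now apply ex_RInt_swap.
  rewrite <- E.
  rewrite <- (RInt_opp (V := R_CompleteNormedModule)).
  - apply (RInt_ext (V := R_CompleteNormedModule)). intros t _. unfold k, opp, scal; simpl.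
    unfold mult; simpl.
    replace (1 - (-1 * t + 1)) with t by ring. replace (-1 * t + 1) with (1 - t) by ring.
    replace (t * x + (1 - t) * y) with ((1 - t) * y + t * x) by ring. ring.
  - apply (ex_RInt_comp_lin k (-1) 1 0 1).
    replace (-1 * 0 + 1) with 1 by ring. replace (-1 * 1 + 1) with 0 by ring.
    now apply ex_RInt_swap.
Qed.

(** [phi] is uniformly continuous on a compact interval that contains all the
    segments between points near [x] and [y], and the weights are at most 1. *)
Lemma J_continuous i j phi x y :
  (forall s, halfline s -> continuous phi s) -> 0 < x -> 0 < y ->
  continuity_2d_pt (J i j phi) x y.
Proof.
  intros Hphi Hx Hy eps.
  set (c := Rmin x y / 2). set (d := Rmax x y + c).
  assert (Hm : 0 < Rmin x y) by now apply Rmin_pos.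
  assert (Hc : 0 < c) by (unfold c; lra).
  pose proof (cond_pos eps) as He.
  assert (He2 : 0 < eps / 2) by lra.
  destruct (unifcont_1d phi c d) with (eps := mkposreal _ He2) as [del Hdel].
  { intros s Hs. apply Hphi. unfold halfline. lra. }
  exists (mkposreal _ (Rmin_pos _ _ (cond_pos del) Hc)). simpl.
  intros u v Hu Hv.
  pose proof (Rmin_l del c) as M1. pose proof (Rmin_r del c) as M2.
  set (r := Rmin del c) in *. clearbody r.
  pose proof (Rmin_l x y). pose proof (Rmin_r x y).
  pose proof (Rmax_l x y). pose proof (Rmax_r x y).
  apply Rabs_def2 in Hu. apply Rabs_def2 in Hv.
  assert (Pu : 0 < u) by (unfold c in *; lra).
  assert (Pv : 0 < v) by (unfold c in *; lra).
  unfold J.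
  pose proof (J_integrable i j phi x y Hphi Hx Hy) as E1.
  pose proof (J_integrable i j phi u v Hphi Pu Pv) as E2.
  assert (E3 := RInt_minus (V := R_CompleteNormedModule) _ _ _ _ E2 E1).
  unfold minus, plus, opp in E3; simpl in E3. unfold Rminus at 1. rewrite <- E3.
  apply Rle_lt_trans with ((1 - 0) * (eps / 2)); [|lra].
  apply abs_RInt_le_const; [lra| |].
  { apply (ex_RInt_minus (V := R_CompleteNormedModule) _ _ _ _ E2 E1). }
  intros t Ht.
  set (w := t ^ i * (1 - t) ^ j).
  assert (Hw : 0 <= w <= 1).
  { unfold w. assert (forall (a : R) k, 0 <= a <= 1 -> 0 <= a ^ k <= 1) as Hp.
    { intros a k Ha. split; [apply pow_le; lra|].
      rewrite <- (pow1 k). apply pow_incr; lra. }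
    pose proof (Hp t i Ht). assert (0 <= 1 - t <= 1) as Ht' by lra.
    pose proof (Hp (1 - t) j Ht'). nra. }
  set (p := (1 - t) * u + t * v). set (q := (1 - t) * x + t * y).
  assert (Hpq : Rabs (p - q) < r).
  { assert (S1 := segment_pos (r - (u - x)) (r - (v - y)) t ltac:(lra) ltac:(lra) Ht).
    assert (S2 := segment_pos (r + (u - x)) (r + (v - y)) t ltac:(lra) ltac:(lra) Ht).
    apply Rabs_def1; unfold p, q; lra. }
  pose proof (segment_between x y t Ht) as Hq. fold q in Hq.
  pose proof (Rabs_def2 _ _ Hpq) as Hp.
  assert (Hphi' : Rabs (phi p - phi q) < eps / 2).
  { apply Rnot_le_lt. intros L. apply (Hdel q p); [unfold d, c in *; lra ..| |].
    { apply Rlt_le_trans with r; [exact Hpq | exact M1]. }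
    intros B. apply (Rlt_not_le _ _ B). exact L. }
  replace (w * phi p + - (w * phi q)) with (w * (phi p - phi q)) by ring.
  rewrite Rabs_mult, (Rabs_pos_eq w) by lra.
  pose proof (Rabs_pos (phi p - phi q)). nra.
Qed.

Lemma J_derive_x i j phi dphi :
  (forall s, halfline s -> is_derive phi s (dphi s)) ->
  (forall s, halfline s -> continuous dphi s) ->
  forall x y, 0 < x -> 0 < y ->
  is_derive (fun z => J i j phi z y) x (J i (S j) dphi x y).
Proof.
  intros Hd Hc x y Hx Hy.
  assert (Hphi : forall s, halfline s -> continuous phi s).
  { intros s Hs. apply (is_derive_contR _ _ _ (Hd s Hs)). }
  set (K := fun z t => t ^ i * (1 - t) ^ j * phi ((1 - t) * z + t * y)).
  assert (HK : forall z t, 0 < (1 - t) * z + t * y ->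
    is_derive (fun z => K z t) z
      (t ^ i * (1 - t) ^ S j * dphi ((1 - t) * z + t * y))).
  { intros z t Hp. unfold K.
    replace (t ^ i * (1 - t) ^ S j * dphi ((1 - t) * z + t * y))
      with (0 * phi ((1 - t) * z + t * y)
            + t ^ i * (1 - t) ^ j * (dphi ((1 - t) * z + t * y) * (1 - t)))
      by (simpl; ring).
    apply (is_derive_multR (fun _ => t ^ i * (1 - t) ^ j)
             (fun z => phi ((1 - t) * z + t * y))).
    - apply @is_derive_const.
    - apply (is_derive_compR phi (fun z => (1 - t) * z + t * y)); [now apply Hd|].
      auto_derive; [exact I | ring]. }
  replace (J i (S j) dphi x y)
    with (RInt (fun t => Derive (fun z => K z t) x) 0 1).
  2:{ apply (RInt_ext (V := R_CompleteNormedModule)).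
      rewrite Rmin_left, Rmax_right by lra. intros t Ht.
      apply is_derive_unique. apply HK. apply segment_pos; lra. }
  apply (is_derive_RInt_param K 0 1 x); rewrite ?Rmin_left, ?Rmax_right by lra.
  - generalize (halfline_open x Hx). apply filter_imp. intros z Hz t Ht.
    eexists. apply HK. now apply segment_pos.
  - intros t Ht.
    assert (Hs : continuity_2d_pt (fun u v => (1 - v) * u + v * y) x t).
    { apply continuity_2d_pt_plus; apply continuity_2d_pt_mult.
      - apply continuity_2d_pt_minus; [apply continuity_2d_pt_const | apply continuity_2d_pt_id2].
      - apply continuity_2d_pt_id1.
      - apply continuity_2d_pt_id2.
      - apply continuity_2d_pt_const. }
    pose proof (segment_pos x y t Hx Hy Ht) as Hp.
    apply continuity_2d_pt_ext_loc with
      (f := fun u v => v ^ i * (1 - v) ^ S j * dphi ((1 - v) * u + v * y)).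
    (* The parameter [v] ranges over a neighbourhood of [t], which leaves
       [[0, 1]] when [t] is an endpoint; the argument of [phi] is still
       positive there by continuity. *)
    + destruct (Hs (mkposreal _ Hp)) as [d Hd']. exists d. intros u v Hu Hv.
      symmetry. apply is_derive_unique. apply HK.
      specialize (Hd' u v Hu Hv). apply Rabs_def2 in Hd'. simpl in Hd'. lra.
    + apply continuity_2d_pt_mult.
      * apply (continuity_1d_2d_pt_comp (fun v => v ^ i * (1 - v) ^ S j) (fun u v => v)).
        -- apply continuity_pt_filterlim. apply weight_continuous.
        -- apply continuity_2d_pt_id2.
      * apply (continuity_1d_2d_pt_comp dphi); [|exact Hs].
        apply continuity_pt_filterlim. apply Hc. exact Hp.
  - generalize (halfline_open x Hx). apply filter_imp. intros z Hz.
    now apply J_integrable.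
Qed.

Lemma J_Cn2 n : forall i j phi, Cn_on halfline n phi -> Cn2 n (J i j phi).
Proof.
  induction n as [|n IH]; intros i j phi Hphi; split; try exact I;
    try (intros; apply J_continuous; auto; now apply (Cn_on_cont _ _ _ Hphi)).
  pose proof (Cn_on_cont _ _ _ Hphi) as Hc.
  destruct Hphi as (dphi & Hd & Hn). pose proof (Cn_on_cont _ _ _ Hn) as Hc'.
  exists (J i (S j) dphi), (J (S i) j dphi).
  split; [now apply J_derive_x|]. split; [|split; now apply IH].
  intros x y Hx Hy. rewrite J_sym by auto.
  apply is_derive_ext_loc with (f := fun z => J j i phi z x).
  - generalize (halfline_open y Hy). apply filter_imp. intros z Hz. now apply J_sym.
  - now apply J_derive_x.
Qed.

Lemma J_RInt phi x y :
  (forall s, halfline s -> continuous phi s) -> 0 < x -> 0 < y ->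
  (y - x) * J 0 0 phi x y = RInt phi x y.
Proof.
  intros Hphi Hx Hy. unfold J.
  assert (E := RInt_comp_lin phi (y - x) x 0 1).
  replace ((y - x) * 0 + x) with x in E by ring.
  replace ((y - x) * 1 + x) with y in E by ring.
  rewrite <- E.
  - rewrite <- (RInt_scal (V := R_CompleteNormedModule)).
    + apply (RInt_ext (V := R_CompleteNormedModule)). intros t _.
      unfold scal; simpl; unfold mult; simpl.
      replace ((1 - t) * x + t * y) with ((y - x) * t + x) by ring. ring.
    + now apply (J_integrable 0 0).
  - apply (@ex_RInt_continuous R_CompleteNormedModule). intros z Hz.
    apply Hphi. pose proof (Rmin_pos x y Hx Hy). unfold halfline. lra.
Qed.

(** * Barycentres of a density *)

(** The equation is multiplied out so that it makes sense, and holds, for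
    [a = b] too. *)
Definition barycentric (h : R -> R) (M : R -> R -> R) : Prop :=
  forall a b, 0 < a -> 0 < b -> M a b * RInt h a b = RInt (fun s => s * h s) a b.

Lemma between_pos a b s : 0 < a -> 0 < b -> Rmin a b <= s <= Rmax a b -> 0 < s.
Proof. intros Ha Hb Hs. pose proof (Rmin_pos a b Ha Hb). lra. Qed.

Lemma ex_RInt_halfline (phi : R -> R) a b :
  (forall s, halfline s -> continuous phi s) -> 0 < a -> 0 < b -> ex_RInt phi a b.
Proof.
  intros Hc Ha Hb. apply (@ex_RInt_continuous R_CompleteNormedModule).
  intros s Hs. apply Hc. now apply (between_pos a b).
Qed.

Lemma primitive_halfline (phi : R -> R) a t :
  (forall s, halfline s -> continuous phi s) -> 0 < a -> 0 < t ->
  is_derive (fun t => RInt phi a t) t (phi t).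
Proof.
  intros Hc Ha Ht. apply (is_derive_RInt phi (fun t => RInt phi a t) a t).
  - generalize (halfline_open t Ht). apply filter_imp. intros s Hs.
    apply (@RInt_correct R_CompleteNormedModule). now apply ex_RInt_halfline.
  - now apply Hc.
Qed.

Lemma smooth_id_mult h : smooth halfline h -> smooth halfline (fun s => s * h s).
Proof. intros H n. apply Cn_on_mult; [apply Cn_on_id | apply H]. Qed.

Lemma smooth_derive D f :
  is_open D -> smooth D f -> (forall x, D x -> is_derive f x (Derive f x)) /\ smooth D (Derive f).
Proof.
  intros HD Hf. split.
  - intros x Hx. apply Derive_correct. destruct (Hf 1%nat) as (f' & H & _).
    exists (f' x). auto.
  - intros n. now apply Cn_on_Derive.
Qed.

Lemma smooth_pos2_derive M :
  smooth_pos2 M ->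
  (forall x y, 0 < x -> 0 < y -> is_derive (fun z => M z y) x (Derive (fun z => M z y) x))
  /\ smooth_pos2 (fun x y => Derive (fun z => M z y) x).
Proof.
  intros HM. split.
  - intros x y Hx Hy. apply Derive_correct. exact (proj1 (proj2 (HM 1%nat x y Hx Hy))).
  - intros n x y Hx Hy. exact (proj1 (proj2 (proj2 (proj2 (HM (S n) x y Hx Hy))))).
Qed.

Lemma mean_diag M x : is_mean M -> 0 < x -> M x x = x.
Proof.
  intros (_ & Hb & _) Hx. specialize (Hb x x Hx Hx).
  rewrite Rmin_left, Rmax_left in Hb by lra. lra.
Qed.

(** Write [m t = M t x] and [D t = int_x^t h].  At [t = x] one has [D = 0] and
    [m = x], so the second derivative of [m * D = int_x^t s * h s ds] yields
    [m' = 1/2], and the third one [3 m'' h = h' / 2]. *)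
Lemma char_fun_barycentric h M x :
  is_mean M -> smooth halfline h -> h x <> 0 -> barycentric h M -> 0 < x ->
  char_fun M x = Derive h x / (6 * h x).
Proof.
  intros HM Hh Hn0 Hbar Hx.
  destruct (smooth_pos2_derive M (proj1 HM)) as [d1 S1].
  destruct (smooth_pos2_derive _ S1) as [d2 S2].
  destruct (smooth_pos2_derive _ S2) as [d3 _].
  destruct (smooth_derive _ _ halfline_open Hh) as [e1 T1].
  destruct (smooth_derive _ _ halfline_open T1) as [e2 _].
  pose proof (Cn_on_cont _ _ _ (Hh O)) as Hc.
  pose proof (Cn_on_cont _ _ _ (smooth_id_mult h Hh O)) as Hsc.
  set (D := fun t => RInt h x t).
  assert (dD : forall t, 0 < t -> is_derive D t (h t)).
  { intros t Ht. now apply primitive_halfline. }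
  assert (D0 : D x = 0) by apply (RInt_point x h).
  set (m := fun t => M t x).
  set (m1 := Derive m). set (m2 := Derive m1). set (m3 := Derive m2 x).
  change (char_fun M x) with (m2 x).
  assert (dm : forall t, 0 < t -> is_derive m t (m1 t)) by (intros; now apply d1).
  assert (dm1 : forall t, 0 < t -> is_derive m1 t (m2 t)).
  { intros t Ht. apply (d2 t x Ht Hx). }
  assert (dm2 : is_derive m2 x m3) by (apply (d3 x x Hx Hx)).
  assert (mx : m x = x) by now apply mean_diag.
  set (h1 := Derive h) in *. set (h2 := Derive h1) in *.
  assert (E0 : forall t, 0 < t -> m t * D t = RInt (fun s => s * h s) x t).
  { intros t Ht. unfold m, D.
    rewrite (proj2 (proj2 HM) t x Ht Hx). now apply Hbar. }
  assert (E1 : forall t, 0 < t -> m1 t * D t + m t * h t = t * h t).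
  { intros t Ht.
    apply (derive_eq_on_open halfline _ _ t _ _ halfline_open Ht E0).
    - apply is_derive_multR; auto.
    - now apply (primitive_halfline (fun s => s * h s)). }
  assert (E2 : forall t, 0 < t ->
    (m2 t * D t + m1 t * h t) + (m1 t * h t + m t * h1 t) = 1 * h t + t * h1 t).
  { intros t Ht.
    apply (derive_eq_on_open halfline _ _ t _ _ halfline_open Ht E1).
    - apply is_derive_plusR; apply is_derive_multR; auto.
    - apply (is_derive_multR (fun t => t)); [apply @is_derive_id | auto]. }
  assert (E3 : ((m3 * D x + m2 x * h x) + (m2 x * h x + m1 x * h1 x))
      + ((m2 x * h x + m1 x * h1 x) + (m1 x * h1 x + m x * h2 x))
      = (0 * h x + 1 * h1 x) + (1 * h1 x + x * h2 x)).
  { apply (derive_eq_on_open halfline _ _ x _ _ halfline_open Hx E2).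
    - apply is_derive_plusR; apply is_derive_plusR; apply is_derive_multR; auto.
    - apply is_derive_plusR.
      + apply (is_derive_multR (fun _ => 1)); [apply @is_derive_const | auto].
      + apply (is_derive_multR (fun t => t)); [apply @is_derive_id | auto]. }
  specialize (E2 x Hx). rewrite D0, mx in E2, E3.
  assert (Hm1 : m1 x = 1 / 2).
  { apply Rmult_eq_reg_r with (h x); [lra | exact Hn0]. }
  rewrite Hm1 in E3.
  apply Rmult_eq_reg_r with (6 * h x); [|lra].
  field_simplify; [lra | exact Hn0].
Qed.

Lemma nonvanishing_RInt h a b :
  (forall s, halfline s -> continuous h s) -> (forall s, 0 < s -> h s <> 0) ->
  0 < a -> 0 < b -> a <> b -> RInt h a b <> 0.
Proof.
  intros Hc Hn0 Ha Hb Hab E.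
  (* The mean value theorem for the primitive avoids a discussion of the sign of
     [h] and of the order of [a] and [b]. *)
  destruct (MVT_gen (fun t => RInt h a t) a b h) as (c & Hc1 & Hc2).
  - intros s Hs. apply primitive_halfline; auto. apply (between_pos a b); auto. lra.
  - intros s Hs. apply continuity_pt_filterlim.
    apply (is_derive_contR _ _ (h s)). apply primitive_halfline; auto.
    now apply (between_pos a b).
  - rewrite E, (RInt_point a h) in Hc2. unfold zero in Hc2; simpl in Hc2.
    assert (h c * (b - a) <> 0); [|lra].
    apply Rmult_integral_contrapositive_currified; [|lra].
    apply Hn0. now apply (between_pos a b).
Qed.

(** * From means of the second kind to barycentres *)

Lemma change_of_variable (f g h : R -> R) a b :
  (forall z, 0 < z -> is_derive g z (h z)) -> (forall z, halfline z -> continuous h z) ->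
  (forall z, 0 < z -> f (g z) = z) -> (forall z, 0 < z -> continuous f (g z)) ->
  0 < a -> 0 < b ->
  RInt h a b = g b - g a /\ RInt (fun s => s * h s) a b = RInt f (g a) (g b).
Proof.
  intros Hg Hh Hfg Hf Ha Hb. split.
  - apply (@is_RInt_unique R_CompleteNormedModule).
    apply (is_RInt_derive (V := R_CompleteNormedModule) g h); intros s Hs.
    + apply Hg. now apply (between_pos a b).
    + apply Hh. now apply (between_pos a b).
  - rewrite <- (RInt_comp (V := R_CompleteNormedModule) f g h a b).
    + apply (RInt_ext (V := R_CompleteNormedModule)). intros s Hs.
      rewrite Hfg by (apply (between_pos a b); auto; lra).
      unfold scal; simpl; unfold mult; simpl. ring.
    + intros s Hs. apply Hf. now apply (between_pos a b).
    + intros s Hs. split; [apply Hg | apply Hh]; now apply (between_pos a b).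
Qed.

Lemma strict_monotone_integral (I : R -> Prop) (f : R -> R) x y :
  is_connected I -> strictly_monotonic_on I f -> (forall t, I t -> continuous f t) ->
  I x -> I y -> x < y -> RInt f x y <> (y - x) * f x.
Proof.
  intros HI Hm Hc Hx Hy Hxy.
  assert (E : RInt (fun _ : R => f x) x y = (y - x) * f x).
  { rewrite RInt_const. reflexivity. }
  rewrite <- E.
  assert (Hin : forall t, x <= t <= y -> I t) by (intros t Ht; now apply (HI x y)).
  destruct Hm as [Hm|Hm].
  - apply Rgt_not_eq. apply RInt_lt; auto.
    + intros t _. apply continuous_const.
    + intros t Ht. apply Hm; auto; [apply Hin|]; lra.
  - apply Rlt_not_eq. apply RInt_lt; auto.
    + intros t _. apply continuous_const.
    + intros t Ht. apply Hm; auto; [apply Hin|]; lra.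
Qed.

(** The values [f t / 2] and [2 * f t] are taken on opposite sides of [t]. *)
Lemma monotone_onto_halfline_no_endpoint (I : R -> Prop) f :
  is_connected I -> strictly_monotonic_on I f ->
  (forall z : R, (exists t : R, I t /\ f t = z) <-> 0 < z) ->
  forall t, I t -> exists a b, I a /\ I b /\ a < t < b.
Proof.
  intros HI Hm Hs t Ht.
  assert (Hft : 0 < f t) by (apply Hs; now exists t).
  destruct (proj2 (Hs (f t / 2)) ltac:(lra)) as (p & Hp & Ep).
  destruct (proj2 (Hs (f t * 2)) ltac:(lra)) as (q & Hq & Eq).
  assert (Hne : p <> t /\ q <> t).
  { split; intros E; subst; lra. }
  destruct Hne as [N1 N2].
  destruct Hm as [Hm|Hm]; [exists p, q | exists q, p]; repeat split; auto;
   apply Rnot_le_lt; intros [L|L]; auto.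
  - specialize (Hm _ _ Ht Hp L). lra.
  - specialize (Hm _ _ Hq Ht L). lra.
  - specialize (Hm _ _ Ht Hq L). lra.
  - specialize (Hm _ _ Hp Ht L). lra.
Qed.

(** If [f' x = 0], the derivative in [x] of
    [M (f x) (f y) * (y - x) = int_x^y f] reads [- M (f x) (f y) = - f x]: the
    average of [f] over [[x, y]] would be its value at an endpoint. *)
Lemma second_kind_derive_neq_0 M (I : R -> Prop) f :
  is_mean M -> is_connected I -> is_open I -> strictly_monotonic_on I f -> smooth I f ->
  (forall t, I t -> 0 < f t) ->
  (forall x y : R, I x -> I y -> x <> y -> M (f x) (f y) = 1 / (y - x) * RInt f x y) ->
  forall x y, I x -> I y -> x < y -> Derive f x <> 0.
Proof.
  intros HM HI Ho Hm Hf Hpos Hrep x y Hx Hy Hxy E.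
  destruct (smooth_derive _ _ Ho Hf) as [df _].
  pose proof (Cn_on_cont _ _ _ (Hf O)) as Hc.
  destruct (smooth_pos2_derive M (proj1 HM)) as [dM _].
  specialize (dM (f x) (f y) (Hpos x Hx) (Hpos y Hy)).
  set (M1 := Derive _ _) in dM.
  pose proof (df x Hx) as dfx. rewrite E in dfx.
  pose (D := fun t => I t /\ t < y).
  assert (HD : is_open D).
  { intros t [Ht Hty]. apply filter_and; [now apply Ho | now apply open_lt]. }
  assert (Heq : forall t, D t -> M (f t) (f y) * (y + -1 * t) = RInt f t y).
  { intros t [Ht Hty]. rewrite Hrep by (auto; lra). field. lra. }
  assert (dL : is_derive (fun t => M (f t) (f y) * (y + -1 * t)) x
            (M1 * 0 * (y + -1 * x) + M (f x) (f y) * (-1))).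
  { apply (is_derive_multR (fun t => M (f t) (f y)) (fun t => y + -1 * t)).
    - apply (is_derive_compR (fun z => M z (f y)) f); auto.
    - auto_derive; [exact Logic.I | ring]. }
  assert (dR : is_derive (fun t => RInt f t y) x (- f x)).
  { apply (is_derive_RInt' f (fun t => RInt f t y) x y).
    - generalize (HD x (conj Hx Hxy)). apply filter_imp. intros t [Ht Hty].
      apply (@RInt_correct R_CompleteNormedModule).
      apply (@ex_RInt_continuous R_CompleteNormedModule). intros s Hs.
      rewrite Rmin_left, Rmax_right in Hs by lra.
      apply Hc. now apply (HI t y).
    - now apply Hc. }
  pose proof (derive_eq_on_open D _ _ x _ _ HD (conj Hx Hxy) Heq dL dR) as HMx.
  apply (strict_monotone_integral I f x y HI Hm Hc Hx Hy Hxy).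
  rewrite <- (Heq x (conj Hx Hxy)). replace (M (f x) (f y)) with (f x) by lra.
  apply Rminus_diag_uniq. ring.
Qed.

(** The density is the derivative of the inverse of [f]. *)
Lemma second_kind_barycentric M :
  integral_mean_second_kind M ->
  exists h, smooth halfline h /\ (forall z, 0 < z -> h z <> 0) /\ barycentric h M.
Proof.
  intros (HM & I & f & HI & Hm & Hsm & Hs & Hrep).
  pose proof (monotone_onto_halfline_no_endpoint I f HI Hm Hs) as Hside.
  pose proof (interval_open I HI Hside) as Ho.
  assert (Hf : smooth I f) by (intros n; now apply smooth_on_Cn_on).
  assert (Hpos : forall t, I t -> 0 < f t) by (intros t Ht; apply Hs; now exists t).
  assert (Hn0 : forall t, I t -> Derive f t <> 0).
  { intros t Ht. destruct (Hside t Ht) as (_ & b & _ & Hb & _ & Htb).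
    now apply (second_kind_derive_neq_0 M I f) with b. }
  destruct (choose_inverse I halfline f (fun z Hz => proj2 (Hs z) Hz)) as [g Hg].
  pose proof (inverse_monotone I halfline f g Hm Hg) as Hgm.
  assert (Hinj : forall s t, I s -> I t -> f s = f t -> s = t).
  { intros s t Hs' Ht' E. destruct (Rtotal_order s t) as [L|[L|L]]; auto;
    destruct Hm as [Hm|Hm];
    solve [specialize (Hm _ _ Hs' Ht' L); lra | specialize (Hm _ _ Ht' Hs' L); lra]. }
  assert (Hgc : forall b, halfline b -> continuous g b).
  { apply (monotone_continuous I halfline); auto using halfline_open.
    - intros b Hb. now apply Hg.
    - intros a Ha. exists (f a). pose proof (Hpos a Ha) as P. split; [exact P|].
      destruct (Hg (f a) P). now apply Hinj. }
  destruct (smooth_inverse I halfline f g Ho halfline_open Hf Hn0 Hg Hgc) as [dg Sg].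
  destruct (smooth_derive _ _ halfline_open Sg) as [dg' Sh].
  exists (Derive g). split; [exact Sh|]. split.
  - intros z Hz. rewrite (is_derive_unique _ _ _ (dg z Hz)).
    apply Rinv_neq_0_compat. apply Hn0. now apply Hg.
  - intros a b Ha Hb.
    destruct (Req_dec a b) as [<-|Hab].
    { rewrite (RInt_point a (Derive g)), (RInt_point a (fun s => s * Derive g s)).
      apply Rmult_0_r. }
    destruct (Hg a Ha) as [Ia Ea]. destruct (Hg b Hb) as [Ib Eb].
    destruct (change_of_variable f g (Derive g) a b) as [E1 E2]; auto.
    + now apply (Cn_on_cont _ O).
    + intros z Hz. now apply Hg.
    + intros z Hz. apply (Cn_on_cont _ _ _ (Hf O)). now apply Hg.
    + assert (Hne : g a <> g b) by (intros E; apply Hab; congruence).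
      specialize (Hrep (g a) (g b) Ia Ib Hne). rewrite Ea, Eb in Hrep.
      rewrite E1, E2, Hrep. field. lra.
Qed.

(** * Minimality *)

(** The quotient [h1 / h2] has zero derivative. *)
Lemma logarithmic_derivative_eq h1 h2 :
  smooth halfline h1 -> smooth halfline h2 ->
  (forall z, 0 < z -> h1 z <> 0) -> (forall z, 0 < z -> h2 z <> 0) ->
  (forall z, 0 < z -> Derive h1 z / h1 z = Derive h2 z / h2 z) ->
  exists c, c <> 0 /\ forall z, 0 < z -> h1 z = c * h2 z.
Proof.
  intros S1 S2 N1 N2 Hq.
  destruct (smooth_derive _ _ halfline_open S1) as [d1 _].
  destruct (smooth_derive _ _ halfline_open S2) as [d2 _].
  set (q := fun z => h1 z * / h2 z).
  assert (dq : forall z, 0 < z -> is_derive q z 0).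
  { intros z Hz. pose proof (N1 z Hz). pose proof (N2 z Hz).
    replace 0 with (Derive h1 z * / h2 z + h1 z * (- Derive h2 z / h2 z ^ 2)).
    - apply (is_derive_multR h1 (fun t => / h2 t)); [now apply d1|].
      apply is_derive_inv; [now apply d2 | assumption].
    - replace (Derive h1 z) with (Derive h2 z / h2 z * h1 z).
      + field. assumption.
      + rewrite <- Hq by assumption. field. assumption. }
  assert (Hq1 : forall z, 0 < z -> q z = q 1).
  { intros z Hz. destruct (MVT_gen q 1 z (fun _ => 0)) as (c & _ & Hc).
    - intros s Hs. apply dq. apply (between_pos 1 z); lra.
    - intros s Hs. apply continuity_pt_filterlim. apply (is_derive_contR _ _ 0).
      apply dq. apply (between_pos 1 z); lra.
    - lra. }
  exists (q 1). split.
  - unfold q. apply Rmult_integral_contrapositive_currified.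
    + apply N1; lra.
    + apply Rinv_neq_0_compat. apply N2; lra.
  - intros z Hz. rewrite <- (Hq1 z Hz). unfold q. field. now apply N2.
Qed.

Lemma barycentric_proportional h1 h2 c M1 M2 a b :
  smooth halfline h1 -> smooth halfline h2 ->
  (forall z, 0 < z -> h1 z <> 0) -> c <> 0 -> (forall z, 0 < z -> h1 z = c * h2 z) ->
  barycentric h1 M1 -> barycentric h2 M2 ->
  0 < a -> 0 < b -> a <> b -> M1 a b = M2 a b.
Proof.
  intros S1 S2 N1 Hc0 Hc B1 B2 Ha Hb Hab.
  apply Rmult_eq_reg_r with (RInt h1 a b).
  2:{ apply nonvanishing_RInt; auto. now apply (Cn_on_cont _ O). }
  rewrite B1 by assumption.
  assert (Hscal : forall k1 k2 : R -> R, (forall z, 0 < z -> k1 z = c * k2 z) ->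
    (forall z, halfline z -> continuous k2 z) -> RInt k1 a b = c * RInt k2 a b).
  { intros k1 k2 Hk Hcont.
    rewrite (RInt_ext (V := R_CompleteNormedModule) k1 (fun z => scal c (k2 z))).
    - apply (RInt_scal (V := R_CompleteNormedModule)). now apply ex_RInt_halfline.
    - intros z Hz. apply Hk. apply (between_pos a b); auto; lra. }
  rewrite (Hscal h1 h2), (Hscal (fun s => s * h1 s) (fun s => s * h2 s)).
  - rewrite <- B2 by assumption. ring.
  - intros z Hz. rewrite Hc by assumption. ring.
  - exact (Cn_on_cont _ _ _ (smooth_id_mult h2 S2 O)).
  - exact Hc.
  - exact (Cn_on_cont _ _ _ (S2 O)).
Qed.

Lemma minimality M1 M2 :
  integral_mean_second_kind M1 -> integral_mean_second_kind M2 ->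
  (forall x, 0 < x -> char_fun M1 x = char_fun M2 x) ->
  forall x y, 0 < x -> 0 < y -> M1 x y = M2 x y.
Proof.
  intros K1 K2 HQ x y Hx Hy.
  destruct (Req_dec x y) as [<-|Hxy].
  { now rewrite (mean_diag M1), (mean_diag M2) by (apply K1 || apply K2 || assumption). }
  destruct (second_kind_barycentric M1 K1) as (h1 & S1 & N1 & B1).
  destruct (second_kind_barycentric M2 K2) as (h2 & S2 & N2 & B2).
  destruct (logarithmic_derivative_eq h1 h2 S1 S2 N1 N2) as (c & Hc0 & Hc).
  { intros z Hz. pose proof (HQ z Hz) as E.
    rewrite (char_fun_barycentric h1 M1 z), (char_fun_barycentric h2 M2 z) in E
      by (auto; apply K1 || apply K2).
    replace (Derive h1 z / h1 z) with (6 * (Derive h1 z / (6 * h1 z)))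
      by (field; auto).
    rewrite E. field. auto. }
  now apply (barycentric_proportional h1 h2 c).
Qed.

(** * Completeness *)

Definition weighted_mean (h : R -> R) (x y : R) : R :=
  J 0 0 (fun s => s * h s) x y * / J 0 0 h x y.

Lemma J_pos h x y :
  smooth halfline h -> (forall s, 0 < s -> 0 < h s) ->
  0 < x -> 0 < y -> 0 < J 0 0 h x y.
Proof.
  intros Hh Hpos Hx Hy. pose proof (Cn_on_cont _ _ _ (Hh O)) as Hc.
  apply RInt_gt_0; [lra| |].
  - intros t Ht. simpl. rewrite !Rmult_1_l. apply Hpos. apply segment_pos; lra.
  - intros t Ht. now apply (J_integrand_continuous 0 0).
Qed.

Lemma weighted_mean_between h x y :
  smooth halfline h -> (forall s, 0 < s -> 0 < h s) ->
  0 < x -> 0 < y -> Rmin x y <= weighted_mean h x y <= Rmax x y.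
Proof.
  intros Hh Hpos Hx Hy. pose proof (J_pos h x y Hh Hpos Hx Hy) as HJ.
  pose proof (Cn_on_cont _ _ _ (Hh O)) as Hc.
  pose proof (Cn_on_cont _ _ _ (smooth_id_mult h Hh O)) as Hsc.
  assert (Hle : Rmin x y * J 0 0 h x y <= J 0 0 (fun s => s * h s) x y
     <= Rmax x y * J 0 0 h x y).
  { assert (Hex := J_integrable 0 0 h x y Hc Hx Hy).
    assert (Hsc' : forall k : R, k * J 0 0 h x y =
      RInt (fun t => k * (t ^ 0 * (1 - t) ^ 0 * h ((1 - t) * x + t * y))) 0 1).
    { intros k. symmetry. apply (RInt_scal (V := R_CompleteNormedModule)). exact Hex. }
    assert (Hexk : forall k : R,
      ex_RInt (fun t => k * (t ^ 0 * (1 - t) ^ 0 * h ((1 - t) * x + t * y))) 0 1).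
    { intros k. apply (ex_RInt_scal (V := R_CompleteNormedModule)). exact Hex. }
    assert (Hex2 := J_integrable 0 0 (fun s => s * h s) x y Hsc Hx Hy).
    assert (Hh0 : forall t, 0 < t < 1 -> 0 <= h ((1 - t) * x + t * y)).
    { intros t Ht. left. apply Hpos. apply segment_pos; lra. }
    rewrite !Hsc'. split; (apply RInt_le; [lra | exact (Hexk _) || exact Hex2 ..|]);
      intros t Ht; simpl; rewrite !Rmult_1_l; apply Rmult_le_compat_r; auto;
      apply segment_between; lra. }
  unfold weighted_mean. split; apply Rmult_le_reg_r with (J 0 0 h x y); auto;
    rewrite Rmult_assoc, Rinv_l, Rmult_1_r by lra; apply Hle.
Qed.

Lemma weighted_mean_is_mean h :
  smooth halfline h -> (forall s, 0 < s -> 0 < h s) ->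
  is_mean (weighted_mean h).
Proof.
  intros Hh Hpos. split; [|split].
  - intros n x y Hx Hy. apply Cn2_ex_diff_n; auto. apply Cn2_mult.
    + apply J_Cn2. now apply smooth_id_mult.
    + apply Cn2_inv.
      * intros u v Hu Hv. apply Rgt_not_eq. now apply J_pos.
      * now apply J_Cn2.
  - intros x y. now apply weighted_mean_between.
  - intros x y Hx Hy. unfold weighted_mean.
    rewrite (J_sym 0 0 h x y), (J_sym 0 0 (fun s : R => s * h s) x y); auto.
    + exact (Cn_on_cont _ _ _ (smooth_id_mult h Hh O)).
    + exact (Cn_on_cont _ _ _ (Hh O)).
Qed.

Lemma weighted_mean_barycentric h :
  smooth halfline h -> (forall s, 0 < s -> 0 < h s) ->
  barycentric h (weighted_mean h).
Proof.
  intros Hh Hpos a b Ha Hb. pose proof (J_pos h a b Hh Hpos Ha Hb) as HJ.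
  rewrite <- J_RInt, <- J_RInt; auto.
  - unfold weighted_mean. field. lra.
  - exact (Cn_on_cont _ _ _ (smooth_id_mult h Hh O)).
  - exact (Cn_on_cont _ _ _ (Hh O)).
Qed.

(** The interval is the image of the primitive [g] of [h] vanishing at 1, and [f]
    is the inverse of [g]. *)
Lemma weighted_mean_second_kind h :
  smooth halfline h -> (forall s, 0 < s -> 0 < h s) ->
  integral_mean_second_kind (weighted_mean h).
Proof.
  intros Hh Hpos. split; [now apply weighted_mean_is_mean|].
  pose proof (Cn_on_cont _ _ _ (Hh O)) as Hc.
  set (g := fun t => RInt h 1 t).
  assert (dg : forall z, halfline z -> is_derive g z (h z)).
  { intros z Hz. apply primitive_halfline; auto. lra. }
  assert (Sg : smooth halfline g).
  { intros [|n].
    - intros z Hz. apply (is_derive_contR _ _ _ (dg z Hz)).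
    - exists h. split; [exact dg | apply Hh]. }
  set (I := fun s => exists z, halfline z /\ g z = s).
  assert (gcont : forall z, halfline z -> continuity_pt g z).
  { intros z Hz. apply continuity_pt_filterlim. exact (Sg O z Hz). }
  assert (Hgi : forall x y, halfline x -> halfline y -> x < y -> g x < g y).
  { intros x y Hx Hy Hxy.
    destruct (MVT_gen g x y h) as (c & Hc1 & Hc2).
    - intros s Hs. apply dg. apply (between_pos x y); auto. lra.
    - intros s Hs. apply gcont. now apply (between_pos x y).
    - pose proof (Hpos c (between_pos x y c Hx Hy Hc1)).
      assert (0 < h c * (y - x)) by (apply Rmult_lt_0_compat; lra). lra. }
  assert (Hgm : strictly_monotonic_on halfline g) by now left.
  assert (HIc : is_connected I).
  { intros a b s (x & Hx & <-) (y & Hy & <-) Hs.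
    destruct (Rtotal_order x y) as [L|[<-|L]].
    - destruct (f_interv_is_interv g x y s L Hs) as (z & Hz & Ez).
      + intros z Hz. apply gcont. unfold halfline in *. lra.
      + exists z. split; [unfold halfline in *; lra | exact Ez].
    - exists x. split; [exact Hx | lra].
    - specialize (Hgi y x Hy Hx L). lra. }
  assert (Ho : is_open I).
  { apply interval_open; [exact HIc|]. intros s (z & Hz & <-).
    unfold halfline in Hz.
    exists (g (z / 2)), (g (z * 2)).
    split; [exists (z / 2); unfold halfline; split; [lra | reflexivity]|].
    split; [exists (z * 2); unfold halfline; split; [lra | reflexivity]|].
    split; apply Hgi; unfold halfline; lra. }
  destruct (choose_inverse halfline I g (fun s Hs => Hs)) as [f Hf].
  assert (Hgf : forall z, halfline z -> f (g z) = z).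
  { intros z Hz. destruct (Hf (g z) (ex_intro _ z (conj Hz eq_refl))) as [H1 H2].
    destruct (Rtotal_order (f (g z)) z) as [L|[L|L]]; auto.
    - specialize (Hgi _ _ H1 Hz L). lra.
    - specialize (Hgi _ _ Hz H1 L). lra. }
  pose proof (inverse_monotone halfline I g f Hgm Hf) as Hfm.
  assert (Hfc : forall s, I s -> continuous f s).
  { apply (monotone_continuous halfline I); auto using halfline_open.
    - intros s Hs. now apply Hf.
    - intros z Hz. exists (g z). split; [now exists z | now apply Hgf]. }
  assert (Hn0 : forall z, halfline z -> Derive g z <> 0).
  { intros z Hz. rewrite (is_derive_unique _ _ _ (dg z Hz)).
    apply Rgt_not_eq. now apply Hpos. }
  destruct (smooth_inverse halfline I g f halfline_open Ho Sg Hn0 Hf Hfc) as [_ Sf].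
  exists I, f. split; [exact HIc|]. split; [exact Hfm|].
  split; [now apply Cn_on_smooth_on|]. split.
  - intros z. split.
    + intros (t & Ht & <-). now apply Hf.
    + intros Hz. exists (g z). split; [now exists z | now apply Hgf].
  - intros s t (a & Ha & <-) (b & Hb & <-) Hst.
    rewrite !Hgf by assumption.
    destruct (change_of_variable f g h a b) as [E1 E2]; auto.
    + intros z Hz. apply Hfc. now exists z.
    + pose proof (weighted_mean_barycentric h Hh Hpos a b Ha Hb) as B.
      rewrite E1, E2 in B. rewrite <- B. field. lra.
Qed.

(** The density is [exp (6 * int_1^x u)], a positive solution of [h' / (6 h) = u]. *)
Lemma completeness u :
  smooth_on halfline u ->
  exists M, integral_mean_second_kind M /\ forall x, 0 < x -> char_fun M x = u x.
Proof.
  intros Hu0. assert (Hu : smooth halfline u) by (intros n; now apply smooth_on_Cn_on).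
  pose proof (Cn_on_cont _ _ _ (Hu O)) as Hc.
  set (U := fun t => RInt u 1 t).
  assert (dU : forall t, halfline t -> is_derive U t (u t)).
  { intros t Ht. apply primitive_halfline; auto. lra. }
  set (h := fun t => exp (6 * U t)).
  assert (dh : forall t, halfline t -> is_derive h t (6 * u t * h t)).
  { intros t Ht.
    replace (6 * u t * h t) with (exp (6 * U t) * (0 * U t + 6 * u t)) by (unfold h; ring).
    apply (is_derive_compR exp (fun t => 6 * U t)); [apply is_derive_exp|].
    apply (is_derive_multR (fun _ => 6)); [apply @is_derive_const | auto]. }
  assert (Sh : smooth halfline h).
  { intros n. induction n as [|n IH].
    - intros t Ht. apply (is_derive_contR _ _ _ (dh t Ht)).
    - exists (fun t => 6 * u t * h t). split; [exact dh|].
      apply Cn_on_mult; [apply Cn_on_mult; [apply Cn_on_const | apply Hu] | exact IH]. }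
  assert (Hp : forall t, 0 < t -> 0 < h t) by (intros; apply exp_pos).
  exists (weighted_mean h). split; [now apply weighted_mean_second_kind|].
  intros x Hx. pose proof (Rgt_not_eq _ _ (Hp x Hx)) as Hn0.
  rewrite (char_fun_barycentric h _ x (weighted_mean_is_mean h Sh Hp) Sh Hn0
             (weighted_mean_barycentric h Sh Hp) Hx).
  rewrite (is_derive_unique _ _ _ (dh x Hx)). field. exact Hn0.
Qed.

Theorem corollary3p35 :
  (forall M1 M2 : R -> R -> R,
     integral_mean_second_kind M1 ->
     integral_mean_second_kind M2 ->
     (forall x : R, 0 < x -> char_fun M1 x = char_fun M2 x) ->
     forall x y : R, 0 < x -> 0 < y -> M1 x y = M2 x y) /\
  (forall u : R -> R,
     smooth_on (fun x : R => 0 < x) u ->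
     exists M : R -> R -> R,
       integral_mean_second_kind M /\
       (forall x : R, 0 < x -> char_fun M x = u x)).
Proof. split; [exact minimality | exact completeness]. Qed.
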